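(* Let $\mathcal{M}=(E,\rho)$ be a $q$-polymatroid with denominator $\mu$. Then \[ \rho(V)=\max\{\rho(I)\mid I\in\mathcal{I}_{\mu}(V)\}\quad\text{for all }V\in\mathcal{V}(E). \]
   Context: Throughout, $\mathbb{F}=\mathbb{F}_q$ is a finite field and $E$ is a finite-dimensional $\mathbb{F}$-vector space. $V\leq W$ means that $V$ is a subspace of $W$, and $\mathcal{V}(E)$ is the set of all subspaces of $E$. A $q$-rank function on $E$ is a map $\rho:\mathcal{V}(E)\to\mathbb{Q}_{\geq0}$ such that for all $V,W\in\mathcal{V}(E)$: (R1) $0\leq\rho(V)\leq\dim V$; (R2) $V\leq W$ implies $\rho(V)\leq\rho(W)$; (R3) $\rho(V+W)+\rho(V\cap W)\leq\rho(V)+\rho(W)$. A $q$-polymatroid on $E$ is a pair $\mathcal{M}=(E,\rho)$ with $\rho$ a $q$-rank function on $E$. A number $\mu\in\mathbb{Q}_{>0}$ is a denominator of $\mathcal{M}$ if $\mu\rho(V)\in\mathbb{N}_0$ for all $V\in\mathcal{V}(E)$. Let $\mathcal{M}=(E,\rho)$ be a $q$-polymatroid with denominator $\mu$. A space $I\in\mathcal{V}(E)$ is $\mu$-independent if $\rho(J)\geq\frac{\dim J}{\mu}$ for all subspaces $J\leq I$. For $V\in\mathcal{V}(E)$, set $\mathcal{I}_\mu(V)=\{I\in\mathcal{V}(E)\mid I \text{ is } \mu\text{-independent and } I\leq V\}$. *)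

(* Defs.v *)
From HB Require Import structures.
From mathcomp Require Import all_boot all_order all_algebra.

Set Implicit Arguments.
Unset Strict Implicit.
Unset Printing Implicit Defensive.

Import Order.TTheory GRing.Theory Num.Theory.

Local Open Scope ring_scope.

(* Axiom R1 makes the rational-valued rank function nonnegative. *)
Record is_qrank (F : finFieldType) (E : vectType F)
    (rho : {vspace E} -> rat) : Prop := IsQRank {
  qrank_bound : forall V : {vspace E}, 0 <= rho V <= (\dim V)%:R;
  qrank_mono : forall V W : {vspace E}, (V <= W)%VS -> rho V <= rho W;
  qrank_submod : forall V W : {vspace E},
    rho (V + W)%VS + rho (V :&: W)%VS <= rho V + rho W
}.

(* The ground space is the parameter E. *)
Record qpolymatroid (F : finFieldType) (E : vectType F) := QPolymatroid {
  qrank : {vspace E} -> rat;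
  qrankP : is_qrank qrank
}.

Definition is_denominator (F : finFieldType) (E : vectType F)
    (M : qpolymatroid E) (mu : rat) : Prop :=
  0 < mu /\ forall V : {vspace E}, mu * qrank M V \is a Num.nat.

Definition independent (F : finFieldType) (E : vectType F)
    (M : qpolymatroid E) (mu : rat) (I : {vspace E}) : Prop :=
  forall J : {vspace E}, (J <= I)%VS -> (\dim J)%:R / mu <= qrank M J.

Definition indep_in (F : finFieldType) (E : vectType F)
    (M : qpolymatroid E) (mu : rat) (V : {vspace E}) (I : {vspace E}) : Prop :=
  independent M mu I /\ (I <= V)%VS.

(* m = max {f x | P x}; the maximum is attained, so {x | P x} is nonempty. *)
Definition is_max_of (T : Type) (P : T -> Prop) (f : T -> rat) (m : rat) : Prop :=
  (exists2 x, P x & m = f x) /\ (forall x, P x -> f x <= m).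

(* Main.v *)
Require Import Defs.
From mathcomp Require Import all_boot all_order all_algebra.
From mathcomp Require Import lra.

(** The rank of [V] bounds that of its subspaces by monotonicity; the point is
    to find a [mu]-independent [I <= V] of the same rank.  Deleting a direction
    [v] from a space means passing to the complement [V :\: <[v]>] of its line,
    a hyperplane.  Delete directions from [V] as long as one can be deleted
    without lowering the rank, and let [I] be the result.  Ranks are multiples
    of [1 / mu], so deleting any further direction of [I] costs at least
    [1 / mu] ([qrank_lt_step]).  By submodularity the same deletion costs at
    least as much inside any subspace [J] of [I] containing that direction, so
    peeling off the [\dim J] directions of [J] one at a time gives
    [\dim J / mu <= rho J] ([independent_of_hyperplane_drop]). *)

Import Order.TTheory GRing.Theory Num.Theory.
Import VectorInternalTheory.
Local Open Scope ring_scope.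

Lemma dim_diff_line {F : fieldType} {E : vectType F} {V : {vspace E}} {v : E} :
  v \in V -> v != 0 -> \dim V = (\dim (V :\: <[v]>)%VS).+1.
Proof.
move=> vV v0; have := dimv_cap_compl V <[v]>%VS.
have/capv_idPr-> : (<[v]> <= V)%VS by rewrite -memvE.
by rewrite dim_vline v0 add1n.
Qed.

Lemma addv_diff_line {F : fieldType} {E : vectType F} (V J : {vspace E})
    (v : E) : v \in J -> (J <= V)%VS -> (J + (V :\: <[v]>) = V)%VS.
Proof.
move=> vJ JV; apply/eqP; rewrite eqEsubv subv_add JV diffvSl /=.
rewrite -{1}(addv_diff_cap V <[v]>%VS) subv_add addvSr /=.
by apply: subv_trans (capvSr _ _) _; rewrite -memvE (subvP (addvSl _ _)).
Qed.

Lemma qrank_lt_step {F : finFieldType} {E : vectType F} {M : qpolymatroid E}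
    {mu : rat} (hmu : is_denominator M mu) {V W : {vspace E}} :
  qrank M V < qrank M W -> qrank M V + mu^-1 <= qrank M W.
Proof.
case: hmu => mu0 hnat ltVW.
rewrite -(ler_pM2l mu0) mulrDr mulfV ?gt_eqF //.
move: ltVW; rewrite -(ltr_pM2l mu0).
have /natrP[a ->] := hnat V; have /natrP[b ->] := hnat W.
by rewrite ltr_nat natr1 ler_nat.
Qed.

(** For [v] in [J], the hyperplane [I :\: <[v]>] of [I] cuts [J] in a hyperplane
    of [J], so submodularity bounds the drop inside [J] below by the drop inside
    [I], and induction on [\dim J] applies to the intersection. *)
Lemma independent_of_hyperplane_drop {F : finFieldType} {E : vectType F}
    {M : qpolymatroid E} {mu : rat} (hmu : is_denominator M mu)
    (I : {vspace E}) :
  (forall v, v \in I -> v != 0 -> qrank M (I :\: <[v]>)%VS < qrank M I) ->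
  independent M mu I.
Proof.
move=> drop J; have [n dimJ] := ubnP (\dim J); move: dimJ.
elim: n J => // n IHn J; rewrite ltnS => leJn JI.
have [->|J0] := eqVneq J 0%VS.
  by rewrite dimv0 mul0r; case/andP: (qrank_bound (qrankP M) 0%VS).
have vJ := memv_pick J; set v := vpick J in vJ.
have v0 : v != 0 by rewrite vpick0.
have vI : v \in I by apply: (subvP JI).
set H := (I :\: <[v]>)%VS.
have JH : (J + H = I)%VS by apply: addv_diff_line.
have dimJH : \dim J = (\dim (J :&: H)).+1.
  apply/eqP; rewrite -(eqn_add2r (\dim H)) -dimv_sum_cap JH.
  by rewrite (dim_diff_line vI v0) addSnnS addnC addSnnS.
have step := qrank_lt_step hmu (drop v vI v0).
have sub := qrank_submod (qrankP M) J H; rewrite JH in sub.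
have IH : (\dim (J :&: H))%:R / mu <= qrank M (J :&: H)%VS.
  by apply: IHn; [rewrite -dimJH | apply: subv_trans (capvSl _ _) JI].
rewrite dimJH -addn1 natrD mulrDl mul1r; rewrite -/H in step.
by lra.
Qed.

Lemma independent_same_rank {F : finFieldType} {E : vectType F}
    {M : qpolymatroid E} {mu : rat} (hmu : is_denominator M mu)
    (V : {vspace E}) :
  exists2 I, indep_in M mu V I & qrank M V = qrank M I.
Proof.
have [n dimV] := ubnP (\dim V); elim: n V dimV => // n IHn V.
rewrite ltnS => leVn.
(* Vectors are searched through their coordinates: row vectors over a finite
   field form a finite type, so the existence of a direction that can be
   deleted without lowering the rank is decidable. *)
pose redundant (u : 'rV[F]_(dim E)) := [&& r2v u \in V, r2v u != 0 :> E
  & qrank M (V :\: <[r2v u]>)%VS == qrank M V].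
have [/existsP[u /and3P[uV u0 /eqP eqr]]|nored] := boolP [exists u, redundant u].
  have [|I [indI IW] eqI] := IHn (V :\: <[r2v u]>)%VS.
    by rewrite -dim_diff_line.
  exists I; last by rewrite -eqr.
  by split=> //; apply: subv_trans IW (diffvSl _ _).
exists V => //; split; last exact: subvv.
apply: independent_of_hyperplane_drop => // v vV v0.
rewrite lt_neqAle (qrank_mono (qrankP M)) ?diffvSl // andbT.
have := existsPn nored (v2r v).
by rewrite /redundant v2rK vV v0.
Qed.

Theorem theorem4p1 (F : finFieldType) (E : vectType F) (M : qpolymatroid E)
    (mu : rat) (hmu : is_denominator M mu) (V : {vspace E}) :
  is_max_of (indep_in M mu V) (qrank M) (qrank M V).
Proof.
split; first exact: independent_same_rank.
by move=> I [_ IV]; apply: (qrank_mono (qrankP M)).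
Qed.
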